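(* Let $M_1,M_2\in\mathbb{N}$ be such that $M_1\neq M_2$ and let $u_{\varepsilon,M_1}$ and $u_{\varepsilon,M_2}$ be the local minimizers of $E_\varepsilon$ within $\mathcal{A}_\alpha$ described in the context. Suppose that $$\gamma^\varepsilon:[0,1]\to\mathcal{A}_\alpha\quad\text{with}\quad\gamma^\varepsilon(0)=u_{\varepsilon,M_1}\ \text{ and }\ \gamma^\varepsilon(1)=u_{\varepsilon,M_2}$$ is a continuous path in $\mathcal{A}_\alpha$ that connects $u_{\varepsilon,M_1}$ and $u_{\varepsilon,M_2}$. Fix an $h>0$ and set $$\Lambda_h:=2\pi^2L\left(N-M_1-\frac{\alpha}{2\pi}\right)^2+\frac{2\sqrt2}{3}-h.$$ There exists an $\varepsilon_h>0$ such that the curve $\gamma^\varepsilon$ leaves the set $E_\varepsilon^{\Lambda_h}$ (that is, $\gamma^\varepsilon([0,1])\not\subset E_\varepsilon^{\Lambda_h}$) whenever $\varepsilon<\varepsilon_h$.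
   Context: Fix a constant $L>0$, a positive integer $N$ and $\alpha\in[0,2\pi)$; $\mathbb{N}$ denotes the positive integers. Identify $\mathbb{R}^2$ with $\mathbb{C}$ when convenient. For $\varepsilon>0$ and $u=(u_1,u_2)\in H^1((0,1);\mathbb{R}^2)$ set $$E_\varepsilon(u)=\int_0^1 \frac{\varepsilon}{2}|u'|^2+\frac{1}{4\varepsilon}(|u|^2-1)^2+\frac{L}{2}(u_1u_2'-u_2u_1'-2\pi N)^2\,dx,$$ $$\mathcal{A}_\alpha=\{u\in H^1((0,1);\mathbb{R}^2): u(0)=1,\ u(1)=e^{i\alpha}\}$$ (with the $H^1$ topology). For $\Lambda>0$ the energy sublevel set is $$E_\varepsilon^\Lambda:=\{u\in\mathcal{A}_\alpha: E_\varepsilon(u)<\Lambda\}.$$ Local minimizers $u_{\varepsilon,M}$: for a positive integer $M$ and a fixed number $\rho_0\in(0,1)$, $u_{\varepsilon,M}=\rho_{\varepsilon,M}e^{i\theta_{\varepsilon,M}}$, where $(\rho_{\varepsilon,M},\theta_{\varepsilon,M})$ minimizes $E_\varepsilon(\rho e^{i\theta})$ among all pairs with $\rho\in H^1(0,1)$, $\rho(0)=\rho(1)=1$, $\rho\ge\rho_0$ on $[0,1]$, and $\theta\in H^1(0,1)$ real-valued, $\theta(0)=0$, $\theta(1)=2\pi M+\alpha$. For all sufficiently small $\varepsilon$ (depending on $M$, $\alpha$, $\rho_0$), $u_{\varepsilon,M}$ is an $H^1$-local minimizer of $E_\varepsilon$ within $\mathcal{A}_\alpha$ (i.e. it minimizes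 $E_\varepsilon$ among elements of $\mathcal{A}_\alpha$ in some $H^1$-neighborhood of it), with $\limsup_{\varepsilon\to0}\|\rho_{\varepsilon,M}-1\|_{L^\infty(0,1)}/\varepsilon<\infty$, $\theta_{\varepsilon,M}'\to2\pi M+\alpha$ uniformly on $[0,1]$ as $\varepsilon\to0$, and $E_\varepsilon(u_{\varepsilon,M})\to\frac{L}{2}(2\pi(M-N)+\alpha)^2$ as $\varepsilon\to0$. *)

(* Defs.v *)
From HB Require Import structures.
From mathcomp Require Import all_boot all_order all_algebra.
From mathcomp Require Import all_classical all_reals all_analysis.

Set Implicit Arguments.
Unset Strict Implicit.
Unset Printing Implicit Defensive.

Import Order.TTheory GRing.Theory Num.Theory.
Import numFieldNormedType.Exports.

Local Open Scope classical_set_scope.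
Local Open Scope ring_scope.

(* An element of H^1(0,1) is represented by its continuous representative,    *)
(* given as a total function R -> R of which only the values on [0,1] matter. *)
(* A vector field u = (u_1, u_2) is a function R -> R * R; the topology and   *)
(* the norm that the library puts on R * R are never used.                    *)

Section H1.
Context {R : realType}.
Local Notation mu := (@lebesgue_measure R).

Definition I01 : set R := `]0, 1[.

Definition C1c (phi : R -> R) : Prop :=
  [/\ forall x, derivable phi x 1, continuous (derive1 phi) &
      exists a b : R, [/\ 0 < a, b < 1 & forall x, x \notin `[a, b] -> phi x = 0]].

Definition square_integrable (f : R -> R) : Prop :=
  measurable_fun I01 f /\
  (\int[mu]_(x in I01) ((f x ^+ 2)%:E) < +oo)%E.

Definition is_weak_derivative (u v : R -> R) : Prop :=
  forall phi : R -> R, C1c phi ->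
    \int[mu]_(x in I01) (u x * derive1 phi x) =
    - \int[mu]_(x in I01) (v x * phi x).

(* u is square integrable on (0,1), being continuous on [0,1]. *)
Definition H1 (u : R -> R) : Prop :=
  {within `[0, 1], continuous u} /\
  exists v, square_integrable v /\ is_weak_derivative u v.

(* For u in H^1(0,1), this is a representative of u', which is only           *)
(* determined almost everywhere; it is used only under integrals.             *)
Definition wderiv (u : R -> R) : R -> R :=
  xget (cst 0) [set v | square_integrable v /\ is_weak_derivative u v].

Definition fst_of (u : R -> R * R) : R -> R := fun x => (u x).1.
Definition snd_of (u : R -> R * R) : R -> R := fun x => (u x).2.

Definition H1vec (u : R -> R * R) : Prop := H1 (fst_of u) /\ H1 (snd_of u).

Definition H1norm (u : R -> R * R) : R :=
  Num.sqrt (\int[mu]_(x in I01)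
    (fst_of u x ^+ 2 + snd_of u x ^+ 2 +
     (wderiv (fst_of u) x ^+ 2 + wderiv (snd_of u) x ^+ 2))).

(* rho e^{i theta} *)
Definition polar (rho theta : R -> R) : R -> R * R :=
  fun x => (rho x * cos (theta x), rho x * sin (theta x)).

End H1.

Section Model.
Context {R : realType}.
Local Notation mu := (@lebesgue_measure R).
Variables (L : R) (N : nat) (alpha : R).

Definition energy_density (eps : R) (u : R -> R * R) (x : R) : R :=
  let u1 := fst_of u x in
  let u2 := snd_of u x in
  let du1 := wderiv (fst_of u) x in
  let du2 := wderiv (snd_of u) x in
  eps / 2 * (du1 ^+ 2 + du2 ^+ 2)
  + (4 * eps)^-1 * (u1 ^+ 2 + u2 ^+ 2 - 1) ^+ 2
  + L / 2 * (u1 * du2 - u2 * du1 - 2 * pi * N%:R) ^+ 2.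

Definition energy (eps : R) (u : R -> R * R) : \bar R :=
  (\int[mu]_(x in I01) (energy_density eps u x)%:E)%E.

Definition admissible : set (R -> R * R) :=
  [set u | [/\ H1vec u, u 0 = (1, 0) & u 1 = (cos alpha, sin alpha)]].

Definition sublevel (eps Lambda : R) : set (R -> R * R) :=
  [set u | admissible u /\ (energy eps u < Lambda%:E)%E].

Definition polar_competitor (rho0 : R) (M : nat) (rho theta : R -> R) : Prop :=
  [/\ H1 rho, rho 0 = 1, rho 1 = 1 & forall x, x \in `[0, 1] -> rho0 <= rho x] /\
  [/\ H1 theta, theta 0 = 0 & theta 1 = 2 * pi * M%:R + alpha].

Definition polar_minimizer (rho0 eps : R) (M : nat) (rho theta : R -> R) : Prop :=
  polar_competitor rho0 M rho theta /\
  forall rho' theta', polar_competitor rho0 M rho' theta' ->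
    (energy eps (polar rho theta) <= energy eps (polar rho' theta'))%E.

(* u is a u_{eps,M}; functions are compared on [0,1] only. *)
Definition is_u_eps_M (rho0 eps : R) (M : nat) (u : R -> R * R) : Prop :=
  exists rho theta, polar_minimizer rho0 eps M rho theta /\
    forall x, x \in `[0, 1] -> u x = polar rho theta x.

(* Only gamma t for t in [0,1] matters. *)
Definition continuous_path (gamma : R -> (R -> R * R)) : Prop :=
  (forall t, t \in `[0, 1] -> admissible (gamma t)) /\
  (forall t, t \in `[0, 1] -> forall eta, 0 < eta ->
     exists2 delta, 0 < delta & forall s, s \in `[0, 1] -> `|s - t| < delta ->
       H1norm (fun x => gamma s x - gamma t x) < eta).

End Model.

(* Main.v *)
Require Import Defs.
From HB Require Import structures.
From mathcomp Require Import all_boot all_order all_algebra.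
From mathcomp Require Import all_classical all_reals all_analysis.
From mathcomp Require Import measurable_realfun ring lra.

Set Implicit Arguments.
Unset Strict Implicit.
Unset Printing Implicit Defensive.

Import Order.TTheory GRing.Theory Num.Theory.
Import numFieldNormedType.Exports.

Local Open Scope classical_set_scope.
Local Open Scope ring_scope.

(** Along the path, the fields that stay at distance at least [2 * dl] from the
    origin have a winding number, and the winding numbers of the two endpoints
    differ.  Hence somewhere the modulus has to drop into the range from [dl]
    to [2 * dl] while the winding is still that of the first endpoint.  Such a
    field pays twice.

    - Modica--Mortola: its modulus goes from 1 to nearly 0 and back to 1, and
      each of the two passages costs at least
      [Num.sqrt 2 / 2 * (2 / 3 - 2 * dl)] of gradient and double-well energy,
      because these two terms dominate [Num.sqrt 2 / 2] times the derivative of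
      [|u| - |u| ^+ 3 / 3], in absolute value ([modica_mortola_pointwise]).
    - Twist: for [u = rho * exp (i * theta)] the twist is
      [rho ^+ 2 * theta'], whereas the winding only fixes the integral of
      [theta'].  As long as [rho >= dl], a small fraction [eta] of the
      double-well term, whose coefficient blows up as [eps] tends to 0, pays
      for the difference ([twist_pointwise]), so the winding still forces the
      twist energy of the first endpoint, up to a small error.

    The fraction [eta], the radius [dl] and the error [sg] depend on [h] (and
    [dl] on [rho0]) but not on [eps]; adding the two costs gives [energy_gap].
    All lower bounds are pointwise: the energy density dominates the
    derivative of an explicit function of [ln rho] and [theta], whose integral
    is then read off at the end points and at the point where [rho] is small.
    In particular convexity enters through tangent lines.

    Everything rests on a calculus of absolutely continuous functions on
    the unit interval: the relation [primitive f v] says that [f] is the indefinite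
    integral of the integrable function [v].  A weak derivative is a derivative
    in this sense ([weak_derivative_primitive]), the chain rule holds
    ([primitive_comp]), and a nonvanishing field has a logarithm whose real and
    imaginary parts are again indefinite integrals ([primitive_log]).  The
    latter gives [theta] without any choice of branches. *)

(** * Induction along an interval *)

Section Interval.
Context {R : realType}.
Implicit Types (f g : R -> R) (a b : R).

(** Only steps that straddle the point [t] are required, so the step length may
    depend on [t]: this replaces the choice of a finite subdivision.  The
    supremum of the points where [P] holds is reached by one step, and that same
    step passes it unless it is [b]. *)
Lemma interval_induction a b (P : R -> Prop) : a <= b -> P a ->
  (forall t, a <= t -> t <= b -> exists2 d, 0 < d &
     forall x y, a <= x -> x <= t -> t <= y -> y <= b ->
       t - x < d -> y - t < d -> P x -> P y) ->
  P b.
Proof.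
move=> ab Pa step.
pose T := [set t | [/\ a <= t, t <= b & P t]].
have Ta : T a by split.
have ubT : ubound T b by move=> x [].
have supT : has_sup T by split; [exists a|exists b].
have as_ : a <= sup T by apply: ub_le_sup => //; exists b.
have sb : sup T <= b by apply: ge_sup => //; exists a.
have [d d0 H] := step _ as_ sb.
have [x [ax xb Px] xs] := sup_adherent d0 supT.
have xleS : x <= sup T by apply: ub_le_sup => //; exists b.
have xd : sup T - x < d by lra.
have [sltb|sgeb] := ltP (sup T) b; last first.
  have -> : b = sup T by apply/eqP; rewrite eq_le sgeb sb.
  by apply: (H x) => //; rewrite subrr.
pose y := Num.min b (sup T + d / 2).
have ys : sup T < y by rewrite lt_min sltb /=; lra.
have yb : y <= b by rewrite ge_min lexx.
have yd : y - sup T < d.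
  have : y <= sup T + d / 2 by rewrite ge_min lexx orbT.
  by lra.
have Ty : T y.
  by split=> //; [lra|apply: (H x) => //; exact: ltW].
have : y <= sup T by apply: ub_le_sup => //; exists b.
by lra.
Qed.

(** The form in which derivative rules are proved below: [d] is the error of the
    rule, [m] the integral of the absolute value of a derivative, and it is
    enough to bound the error over short intervals by a small multiple of the
    mass. *)
Lemma small_increments_const a b (d m : R -> R) : a <= b ->
  (forall eta t, 0 < eta -> a <= t -> t <= b -> exists2 r, 0 < r &
     forall x y, a <= x -> x <= t -> t <= y -> y <= b ->
       t - x < r -> y - t < r -> `|d y - d x| <= eta * (m y - m x)) ->
  d b = d a.
Proof.
move=> ab H; apply/eqP; rewrite -subr_eq0 -normr_le0.
apply/ler_addgt0Pr => e e0; rewrite add0r.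
pose eta := e / (`|m b - m a| + 1).
have p0 : 0 < `|m b - m a| + 1 by rewrite ltr_wpDl.
have eta0 : 0 < eta by rewrite divr_gt0.
have : `|d b - d a| <= eta * (m b - m a).
  apply: (@interval_induction a b (fun t => `|d t - d a| <= eta * (m t - m a))) => //.
    by rewrite !subrr normr0 mulr0.
  move=> t at_ tb; have [r r0 Hr] := H _ _ eta0 at_ tb.
  exists r => // x y ax xt ty yb xr yr Hx.
  have := Hr _ _ ax xt ty yb xr yr.
  have -> : d y - d a = (d y - d x) + (d x - d a) by ring.
  move=> Hy; apply: (le_trans (ler_normD _ _)).
  by apply: (le_trans (lerD Hy Hx)); rewrite -mulrDr; lra.
move/le_trans; apply.
apply: (@le_trans _ _ (eta * (`|m b - m a| + 1))).
  by rewrite ler_pM2l//; apply: (le_trans (ler_norm _)); lra.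
by rewrite /eta divfK// gt_eqF.
Qed.

(** Continuity on a segment with all quantifiers relative to the segment, as
    needed for functions of which only the values on the segment matter. *)
Lemma within_itvP a b f :
  {within `[a, b], continuous f} <->
  forall x, a <= x -> x <= b -> forall e : R, 0 < e -> exists2 d : R, 0 < d &
    forall y, a <= y -> y <= b -> `|y - x| < d -> `|f y - f x| < e.
Proof.
rewrite subspace_continuousP; split.
  move=> H x ax xb e e0.
  have xab : `[a, b]%classic x by rewrite /= in_itv /= ax.
  have /cvgrPdist_lt /(_ _ e0) := H x xab.
  rewrite near_withinE => -[d /= d0 Hd]; exists d => // y ay yb yx.
  rewrite distrC; apply: Hd; first by rewrite /= distrC.
  by rewrite /= in_itv /= ay.
move=> H x; rewrite /= in_itv /= => /andP[ax xb].
apply/cvgrPdist_lt => e e0; rewrite near_withinE.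
have [d d0 Hd] := H x ax xb e e0.
exists d => //= y yx; rewrite in_itv /= => /andP[ay yb].
by rewrite distrC; apply: Hd => //; rewrite distrC.
Qed.

Lemma within_itv_bounded a b f : {within `[a, b], continuous f} ->
  exists2 M, 0 < M & forall x, a <= x -> x <= b -> `|f x| <= M.
Proof.
move=> cf.
have /compact_bounded[M [_ HM]] := continuous_compact cf (@segment_compact R a b).
exists (`|M| + 1) => [|x ax xb]; first by rewrite ltr_wpDl.
apply: HM; first by rewrite (le_lt_trans (ler_norm _))// ltrDl.
by exists x => //=; rewrite in_itv /= ax.
Qed.

Lemma within_itv_measurable a b f : {within `[a, b], continuous f} ->
  measurable_fun `[a, b] f.
Proof. exact: subspace_continuous_measurable_fun. Qed.

End Interval.

(** * Indefinite integrals of integrable functions *)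

Section Primitive.
Context {R : realType}.
Local Notation mu := (@lebesgue_measure R).
Implicit Types (f g v w : R -> R).

Definition L1_01 v := mu.-integrable `[0, 1] (EFin \o v).

(** That is, [f] is absolutely continuous on the unit interval with
    derivative [v] almost everywhere. *)
Definition primitive f v : Prop :=
  L1_01 v /\ forall x y : R, 0 <= x -> x <= y -> y <= 1 ->
    f y - f x = \int[mu]_(t in `[x, y]) v t.

Lemma L1_01_sub v x y : 0 <= x -> y <= 1 -> L1_01 v ->
  mu.-integrable `[x, y] (EFin \o v).
Proof.
move=> x0 y1; apply: integrableS => //.
by apply: subset_itv; rewrite bnd_simp.
Qed.

Lemma eq_L1_01 v w : (forall x, 0 <= x -> x <= 1 -> v x = w x) ->
  L1_01 v -> L1_01 w.
Proof.
move=> vw; apply: eq_integrable => // x; rewrite inE /= in_itv /= => /andP[x0 x1].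
by rewrite vw.
Qed.

Lemma L1_01D v w : L1_01 v -> L1_01 w -> L1_01 (fun x => v x + w x).
Proof.
by move=> iv iw; apply: eq_integrable (integrableD _ iv iw).
Qed.

Lemma L1_01Z k v : L1_01 v -> L1_01 (fun x => k * v x).
Proof. by move=> iv; apply: eq_integrable (integrableZl _ k iv). Qed.

Lemma continuous_L1_01 g : {within `[0, 1], continuous g} -> L1_01 g.
Proof. by move=> cg; apply: continuous_compact_integrable => //; exact: segment_compact. Qed.

Lemma L1_01Ml g v : {within `[0, 1], continuous g} -> L1_01 v ->
  L1_01 (fun x => g x * v x).
Proof.
move=> cg iv; have [M M0 HM] := within_itv_bounded cg.
have := @integrableMr _ _ _ mu `[0, 1]%classic _ g (EFin \o v) _ _ iv.
apply => //; first exact: within_itv_measurable.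
exists M; split; rewrite ?num_real// => x Mx y /=.
by rewrite in_itv /= => /andP[y0 y1]; apply: (le_trans (HM _ y0 y1)); exact: ltW.
Qed.

Lemma eq_primitive f g v w :
  (forall x, 0 <= x -> x <= 1 -> f x = g x) ->
  (forall x, 0 <= x -> x <= 1 -> v x = w x) ->
  primitive f v -> primitive g w.
Proof.
move=> fg vw [iv H]; split; first exact: eq_L1_01 iv.
move=> x y x0 xy y1; rewrite -!fg; try lra.
rewrite H//; apply: eq_Rintegral => t; rewrite inE /= in_itv /= => /andP[xt ty].
by apply: vw; lra.
Qed.

Lemma Rintegral_chasles v x y z : 0 <= x -> x <= y -> y <= z -> z <= 1 ->
  L1_01 v -> \int[mu]_(t in `[x, z]) v t =
    \int[mu]_(t in `[x, y]) v t + \int[mu]_(t in `[y, z]) v t.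
Proof.
move=> x0 xy yz z1 iv.
have ixz := L1_01_sub x0 z1 iv.
rewrite -[X in _ = _ + X]Rintegral_itv_obnd_cbnd; last first.
  apply: integrableS ixz => //; apply: subset_itv; rewrite bnd_simp//.
by rewrite -(Rintegral_itvB ixz) ?bnd_simp// addrC subrK.
Qed.

Lemma integral_primitive v : L1_01 v ->
  primitive (fun x => \int[mu]_(t in `[0, x]) v t) v.
Proof.
move=> iv; split=> // x y x0 xy y1.
by rewrite (Rintegral_chasles _ x0 xy)//; ring.
Qed.

Lemma primitive_continuous f v : primitive f v -> {within `[0, 1], continuous f}.
Proof.
move=> [iv H]; apply/within_itvP => x x0 x1 e e0.
have /within_itvP/(_ x x0 x1 e e0)[d d0 Hd] :=
  parameterized_integral_continuous (@ler01 R) iv.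
exists d => // y y0 y1 yx; have := Hd y y0 y1 yx.
rewrite /parameterized_integral -!H//.
by have -> : f y - f 0 - (f x - f 0) = f y - f x by ring.
Qed.

Lemma primitive_subr0 f v x : primitive f v -> 0 <= x -> x <= 1 ->
  f x = f 0 + \int[mu]_(t in `[0, x]) v t.
Proof. by move=> [_ H] x0 x1; rewrite -H//; ring. Qed.

Lemma primitive_zero_const f v : primitive f v ->
  (forall x, 0 <= x -> x <= 1 -> v x = 0) ->
  forall x, 0 <= x -> x <= 1 -> f x = f 0.
Proof.
move=> pf v0 x x0 x1; rewrite (primitive_subr0 pf)//.
rewrite (@eq_Rintegral _ _ _ _ _ (cst 0)); last first.
  move=> t; rewrite inE /= in_itv /= => /andP[t0 tx].
  by rewrite v0//; lra.
by rewrite Rintegral_cst// mul0r addr0.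
Qed.

Lemma primitiveD f g v w : primitive f v -> primitive g w ->
  primitive (fun x => f x + g x) (fun x => v x + w x).
Proof.
move=> [iv Hf] [iw Hg]; split; first exact: L1_01D.
move=> x y x0 xy y1; rewrite RintegralD//; try exact: L1_01_sub.
by rewrite -Hf// -Hg//; ring.
Qed.

Lemma primitiveZ k f v : primitive f v ->
  primitive (fun x => k * f x) (fun x => k * v x).
Proof.
move=> [iv Hf]; split; first exact: L1_01Z.
move=> x y x0 xy y1; rewrite RintegralZl//; try exact: L1_01_sub.
by rewrite -Hf//; ring.
Qed.

Lemma primitiveB f g v w : primitive f v -> primitive g w ->
  primitive (fun x => f x - g x) (fun x => v x - w x).
Proof.
move=> pf pg; apply: eq_primitive (primitiveD pf (primitiveZ (-1) pg)) => x *;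
ring.
Qed.

Lemma primitive_id : primitive id (cst 1).
Proof.
split; first exact: continuous_L1_01 (continuous_subspaceT (fun=> cvg_cst _)).
move=> x y x0 xy y1; rewrite Rintegral_cst// mul1r /= lebesgue_measure_itv /=.
rewrite lte_fin; case: ltP => [_ |yx] /=; first by [].
by apply: le_anti; apply/andP; split; lra.
Qed.

Lemma primitive_cst (c : R) : primitive (cst c) (cst 0).
Proof.
split; first exact: continuous_L1_01 (continuous_subspaceT (fun=> cvg_cst _)).
by move=> x y *; rewrite Rintegral_cst// mul0r subrr.
Qed.

Lemma within_continuous_comp a b f (F : R -> R) : continuous F ->
  {within `[a, b], continuous f} -> {within `[a, b], continuous (F \o f)}.
Proof.
move=> cF cf; apply/subspace_continuousP => x xab.
by move/subspace_continuousP : cf => /(_ x xab) cf; apply: cvg_comp cf (cF _).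
Qed.

Lemma le_Rintegral_norm v (e : R) w x y : 0 <= x -> y <= 1 -> L1_01 v -> L1_01 w ->
  (forall t, x <= t -> t <= y -> `|w t| <= e * `|v t|) ->
  `|\int[mu]_(t in `[x, y]) w t| <= e * \int[mu]_(t in `[x, y]) `|v t|.
Proof.
move=> x0 y1 iv iw H.
have jv := L1_01_sub x0 y1 iv; have jw := L1_01_sub x0 y1 iw.
apply: (le_trans (le_normr_Rintegral _ jw)) => //.
rewrite -RintegralZl//; last exact: integrable_norm.
apply: le_Rintegral => //; first exact: integrable_norm.
  by apply: eq_integrable (integrableZl _ e (integrable_norm jv)).
by move=> t; rewrite /= in_itv /= => /andP[xt ty]; exact: H.
Qed.

(** Over a short interval around [t] the mean value theorem gives
    [F (f y) - F (f x) = F' c * (f y - f x)] with [c] near [f t]; writing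
    [f y - f x] as the integral of [v] turns the error into the integral of
    [(F' c - F' (f s)) * v s], a small multiple of the integral of [|v|]. *)
Lemma primitive_comp f v (F F' : R -> R) :
  (forall x : R, is_derive x 1 F (F' x)) -> continuous F' ->
  primitive f v -> primitive (F \o f) (fun x => F' (f x) * v x).
Proof.
move=> dF cF' pf; have cf := primitive_continuous pf.
have [iv Hf] := pf.
have cFf : {within `[0, 1], continuous (F' \o f)} by exact: within_continuous_comp.
have iw : L1_01 (fun x => F' (f x) * v x) by exact: L1_01Ml.
split=> // a b a0 ab b1.
pose d x := F (f x) - \int[mu]_(t in `[0, x]) (F' (f t) * v t).
pose m x := \int[mu]_(t in `[0, x]) `|v t|.
have ivn : L1_01 (fun t => `|v t|) by exact: integrable_norm.
suff : d b = d a.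
  rewrite /d (Rintegral_chasles _ a0 ab)// /=; lra.
apply: (@small_increments_const _ _ _ d m ab) => eta t eta0 at_ tb.
have t0 : 0 <= t by lra.
have t1 : t <= 1 by lra.
have cF : continuous F.
  by move=> x; apply: differentiable_continuous; apply/derivable1_diffP; exact: ex_derive.
have eta20 : 0 < eta / 2 by lra.
have /cvgrPdist_lt/(_ _ eta20) := cF' (f t).
move=> -[r /= r0 Hr].
have /within_itvP/(_ t t0 t1 _ r0)[s s0 Hs] := cf.
exists s => // x y ax xt ty yb xs ys.
have x0 : 0 <= x by lra.
have y1 : y <= 1 by lra.
have xy : x <= y by lra.
have Hst z : x <= z -> z <= y -> `|f z - f t| < r.
  by move=> xz zy; apply: Hs; [lra|lra|rewrite ltr_norml; apply/andP; split; lra].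
have Hz c : `|c - f t| < r -> `|F' (f t) - F' c| < eta / 2.
  by move=> H; apply: Hr; rewrite /= distrC.
have mvt p q : p <= q -> exists c, [/\ p <= c, c <= q & F q - F p = F' c * (q - p)].
  move=> pq; have [c] := MVT_segment pq (fun x _ => dF x) (continuous_subspaceT cF).
  by rewrite in_itv /= => /andP[c1 c2] ?; exists c.
have [c cin Hc] : exists2 c, `|c - f t| < r & F (f y) - F (f x) = F' c * (f y - f x).
  have := Hst x (lexx _) xy; have := Hst y xy (lexx _).
  rewrite !ltr_norml => /andP[A1 A2] /andP[B1 B2].
  have [/mvt|/ltW/mvt] := leP (f x) (f y) => -[c [c1 c2 Hc]]; exists c.
  - by rewrite ltr_norml; apply/andP; split; lra.
  - by [].
  - by rewrite ltr_norml; apply/andP; split; lra.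
  - by rewrite -opprB Hc; ring.
have -> : m y - m x = \int[mu]_(t in `[x, y]) `|v t|.
  by rewrite /m (Rintegral_chasles (lexx 0) x0 xy)//; ring.
have -> : d y - d x = \int[mu]_(t in `[x, y]) (F' c * v t - F' (f t) * v t).
  rewrite RintegralB//; first 1 last.
  - exact: (L1_01_sub x0 y1 (L1_01Z _ iv)).
  - exact: (L1_01_sub x0 y1 iw).
  rewrite RintegralZl//; last exact: L1_01_sub.
  rewrite -Hf// -Hc /d (Rintegral_chasles (lexx 0) x0 xy y1)//; ring.
apply: le_Rintegral_norm => //.
  apply: eq_L1_01 (L1_01D (L1_01Z (F' c) iv) (L1_01Z (-1) iw)) => z *; ring.
move=> z xz zy; rewrite -mulrBl normrM ler_wpM2r//.
have := Hz _ cin; have := Hz _ (Hst z xz zy).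
have -> : F' c - F' (f z) = (F' (f t) - F' (f z)) - (F' (f t) - F' c) by ring.
move=> h1 h2; apply: (le_trans (ler_normB _ _)); lra.
Qed.

(** By polarization, from the chain rule for the square. *)
Lemma primitiveM f g v w : primitive f v -> primitive g w ->
  primitive (fun x => f x * g x) (fun x => v x * g x + f x * w x).
Proof.
have sq h z : primitive h z -> primitive (fun x => h x ^+ 2) (fun x => 2 * h x * z x).
  apply: (@primitive_comp _ _ (fun x => x ^+ 2) (fun x => 2 * x)).
    move=> x; have := @is_deriveX R R id 2 x 1 1 (is_derive_id _ _).
    by rewrite /= expr1 => h0; apply: is_derive_eq h0 _; rewrite scaler1.
  by move=> x; apply: cvgM; [exact: cvg_cst|exact: cvg_id].
move=> pf pg.
have := primitiveZ (1/2) (primitiveB (sq _ _ (primitiveD pf pg)) (primitiveD (sq _ _ pf) (sq _ _ pg))).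
by apply: eq_primitive => x _ _; field.
Qed.

End Primitive.

(** * Weak derivatives and indefinite integrals *)

Section WeakDerivative.
Context {R : realType}.
Local Notation mu := (@lebesgue_measure R).
Implicit Types (f g v w u : R -> R).

(** The energy and the weak derivatives are integrals over the open interval,
    the primitives are integrals over closed ones. *)
Lemma integrable_I01P v : mu.-integrable (@I01 R) (EFin \o v) <-> L1_01 v.
Proof.
split=> [|iv]; last first.
  apply: integrableS iv => //; first exact: measurable_itv.
  exact: subset_itv_oo_cc.
move=> /integrableP[mv iv]; apply/integrableP; split.
  by apply/emeasurable_fun_itv_bndo_bndcP/emeasurable_fun_itv_obnd_cbndP.
rewrite -integral_itv_bndo_bndc; last first.
  by apply: measurableT_comp => //; apply/emeasurable_fun_itv_obnd_cbndP.
rewrite -integral_itv_obnd_cbnd//.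
exact: measurableT_comp.
Qed.

Lemma Rintegral_I01 v : L1_01 v ->
  \int[mu]_(x in I01) v x = \int[mu]_(x in `[0, 1]) v x.
Proof.
move=> iv; rewrite -Rintegral_itv_bndo_bndc; last first.
  by apply: integrableS iv => //; apply: subset_itv; rewrite bnd_simp.
rewrite -Rintegral_itv_obnd_cbnd//.
by apply: integrableS iv => //; apply: subset_itv; rewrite bnd_simp.
Qed.

Lemma square_integrable_L1sqr v : square_integrable v -> L1_01 (fun x => v x ^+ 2).
Proof.
move=> [mv iv]; apply/integrable_I01P/integrableP; split.
  by apply/measurable_EFinP; exact: measurable_funX.
under eq_integral do rewrite /= ger0_norm ?sqr_ge0//.
by [].
Qed.

Lemma square_integrable_measurable v : square_integrable v -> measurable_fun `[0%R : R, 1%R] v.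
Proof.
by move=> [mv _]; apply/measurable_fun_itv_bndo_bndcP/measurable_fun_itv_obnd_cbndP.
Qed.

Lemma L1_01_cst (c : R) : L1_01 (cst c).
Proof. exact: continuous_L1_01 (continuous_subspaceT (fun=> cvg_cst _)). Qed.

Lemma L1_01_dominated v w : measurable_fun `[0%R : R, 1%R] v -> L1_01 w ->
  (forall x, 0 <= x -> x <= 1 -> `|v x| <= w x) -> L1_01 v.
Proof.
move=> mv iw H; apply: le_integrable iw => //; first exact/measurable_EFinP.
move=> x; rewrite /= in_itv /= => /andP[x0 x1].
by rewrite lee_fin (le_trans (H x x0 x1))// ler_norm.
Qed.

(** Since [|v * w| <= v ^+ 2 + w ^+ 2]. *)
Lemma square_integrable_L1M v w : square_integrable v -> square_integrable w ->
  L1_01 (fun x => v x * w x).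
Proof.
move=> sv sw; have dom := L1_01D (square_integrable_L1sqr sv) (square_integrable_L1sqr sw).
apply: L1_01_dominated dom _.
  by apply: measurable_funM; exact: square_integrable_measurable.
by move=> x _ _; rewrite ler_norml; apply/andP; split; nra.
Qed.

Lemma square_integrable_L1 v : square_integrable v -> L1_01 v.
Proof.
move=> sv; have dom := L1_01D (square_integrable_L1sqr sv) (L1_01_cst 1).
apply: L1_01_dominated dom _; first exact: square_integrable_measurable.
by move=> x _ _; rewrite ler_norml; apply/andP; split; rewrite /=; nra.
Qed.

Lemma square_integrableB v w : square_integrable v -> square_integrable w ->
  square_integrable (fun x => v x - w x).
Proof.
move=> sv sw; split.
  by apply: measurable_funB; [case: sv|case: sw].
have /integrable_I01P/integrableP[_] :
    L1_01 (fun x => (v x - w x) ^+ 2).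
  apply: eq_L1_01 (L1_01D (L1_01D (square_integrable_L1sqr sv)
    (square_integrable_L1sqr sw)) (L1_01Z (-2) (square_integrable_L1M sv sw))).
  by move=> x _ _; ring.
apply: le_lt_trans; rewrite le_eqVlt; apply/orP; left; apply/eqP.
by apply: eq_integral => x _; rewrite /= ger0_norm// sqr_ge0.
Qed.

Lemma C1c_primitive (phi : R -> R) : C1c phi -> primitive phi (derive1 phi).
Proof.
move=> [dphi cphi _].
apply: eq_primitive (primitive_comp (F := phi) _ cphi (primitive_id)).
- by [].
- by move=> x _ _; rewrite /= mulr1.
- by move=> x; rewrite derive1E; apply: derivableP.
Qed.

Lemma C1c_end0 (phi : R -> R) : C1c phi -> phi 0 = 0 /\ phi 1 = 0.
Proof.
move=> [_ _ [a [b [a0 b1 H]]]].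
by split; apply: H; rewrite in_itv /= negb_and -!ltNge ?a0// b1 orbT.
Qed.

(** The product rule for [f * phi], which vanishes at both ends. *)
Lemma primitive_weak_derivative f v : primitive f v -> is_weak_derivative f v.
Proof.
move=> pf phi Cphi; have pphi := C1c_primitive Cphi.
have [phi0 phi1] := C1c_end0 Cphi.
have i1 : L1_01 (fun x => f x * derive1 phi x).
  by apply: L1_01Ml; [exact: primitive_continuous pf|case: pphi].
have i2 : L1_01 (fun x => v x * phi x).
  apply: (@eq_L1_01 _ (fun x => phi x * v x)); first by move=> *; rewrite mulrC.
  by apply: L1_01Ml; [exact: primitive_continuous pphi|case: pf].
rewrite !Rintegral_I01//.
have [_ /(_ 0 1 (lexx _) ler01 (lexx _))] := primitiveM pf pphi.
rewrite phi0 phi1 !mulr0 subrr RintegralD// => H.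
by apply/eqP; rewrite -addr_eq0 addrC -H.
Qed.

(** Lets one differentiate piecewise polynomial functions without looking at
    the points where the pieces meet. *)
Lemma is_derive_quadratic_error (F : R -> R) (x l C : R) :
  (forall h, `|F (x + h) - F x - l * h| <= C * h ^+ 2) -> is_derive x 1 F l.
Proof.
move=> H.
suff cv : h^-1 *: ((F \o shift x) (h *: (1 : R)) - F x) @[h --> 0^'] --> l.
  split; first by apply/cvg_ex; exists l.
  exact: cvg_lim cv.
apply/cvgrPdist_lt => e e0.
have C1 : 0 < `|C| + 1 by rewrite ltr_wpDl.
exists (e / (`|C| + 1)) => /=; first exact: divr_gt0.
move=> h /=; rewrite sub0r normrN ltr_pdivlMr// => he h0.
have hp : 0 < `|h| by rewrite normr_gt0.
rewrite distrC -(ltr_pM2r hp) -normrM /shift /=.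
have -> : (h^-1 *: (F (h *: 1 + x) - F x) - l) * h = F (x + h) - F x - l * h.
  have -> : h *: 1 + x = x + h by rewrite /GRing.scale /= mulr1 addrC.
  by rewrite /GRing.scale /=; field.
apply: (le_lt_trans (H h)).
have -> : C * h ^+ 2 = C * `|h| * `|h| by rewrite -mulrA -expr2 -normrX ger0_norm ?sqr_ge0.
rewrite ltr_pM2r// (le_lt_trans _ he)// mulrC ler_wpM2l//.
by rewrite (le_trans (ler_norm _))// lerDl.
Qed.

(** Second differences of this function give [C^1] splines. *)
Definition possqr (x : R) : R := Num.max 0 x ^+ 2.

Lemma possqr_taylor (x h : R) :
  `|possqr (x + h) - possqr x - 2 * Num.max 0 x * h| <= h ^+ 2.
Proof.
rewrite /possqr ler_norml.
by have [x0|x0] := leP 0 x; have [y0|y0] := leP 0 (x + h); apply/andP; split; nra.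
Qed.

(** A tent of base [c - r, c + r] and height [2 * r]. *)
Definition hat (c r x : R) : R :=
  2 * (Num.max 0 (x - (c - r)) - 2 * Num.max 0 (x - c) + Num.max 0 (x - (c + r))).

Definition hat_prim (c r x : R) : R :=
  possqr (x - (c - r)) - 2 * possqr (x - c) + possqr (x - (c + r)).

Lemma is_derive_hat_prim (c r x : R) : is_derive x 1 (hat_prim c r) (hat c r x).
Proof.
apply: (@is_derive_quadratic_error _ _ _ 4) => h; rewrite /hat_prim /hat.
have := possqr_taylor (x - (c - r)) h; have := possqr_taylor (x - c) h.
have := possqr_taylor (x - (c + r)) h; rewrite ![x - _ + h]addrAC.
rewrite !ler_norml => /andP[? ?] /andP[? ?] /andP[? ?].
by apply/andP; split; lra.
Qed.

Lemma max0_continuous (k : R) : continuous (fun x : R => Num.max 0 (x + k)).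
Proof.
move=> x; apply: (@continuous_max _ _ (cst 0) (fun x => x + k)); first exact: cvg_cst.
by apply: cvgD; [exact: cvg_id|exact: cvg_cst].
Qed.

Lemma hat_continuous (c r : R) : continuous (hat c r).
Proof.
move=> x; apply: cvgM; first exact: cvg_cst.
apply: cvgD; last exact: max0_continuous.
apply: cvgB; first exact: max0_continuous.
by apply: cvgM; [exact: cvg_cst|exact: max0_continuous].
Qed.

Lemma hat_ge0 (c r x : R) : 0 < r -> 0 <= hat c r x.
Proof.
move=> r0; rewrite /hat.
have [?|?] := leP 0 (x - (c - r)); have [?|?] := leP 0 (x - c);
  have [?|?] := leP 0 (x - (c + r)); lra.
Qed.

Lemma hat_out (c r x : R) : 0 < r -> r <= `|x - c| -> hat c r x = 0.
Proof.
move=> r0; rewrite /hat ler_normr => /orP[]h;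
have [?|?] := leP 0 (x - (c - r)); have [?|?] := leP 0 (x - c);
  have [?|?] := leP 0 (x - (c + r)); lra.
Qed.

Lemma hat_prim_left (c r x : R) : 0 < r -> x <= c - r -> hat_prim c r x = 0.
Proof.
move=> r0 h; rewrite /hat_prim /possqr.
by rewrite !max_l ?expr0n /=; lra.
Qed.

Lemma hat_prim_right (c r x : R) : 0 < r -> c + r <= x -> hat_prim c r x = 2 * r ^+ 2.
Proof.
move=> r0 h; rewrite /hat_prim /possqr.
by rewrite !max_r; [ring|lra..].
Qed.

Lemma hat_primitive (c r : R) : primitive (hat_prim c r) (hat c r).
Proof.
apply: eq_primitive (primitive_comp (is_derive_hat_prim c r) (@hat_continuous c r) primitive_id) => //.
by move=> x _ _; rewrite /= mulr1.
Qed.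

(** The tent has mass [2 * r ^+ 2], so that its integral against [g] is close to
    [2 * r ^+ 2 * g c] when [g] varies little on its support. *)
Lemma hat_average (g : R -> R) (c r e : R) :
  0 < r -> 0 <= c - r -> c + r <= 1 -> {within `[0, 1], continuous g} ->
  (forall x, 0 <= x -> x <= 1 -> `|x - c| < r -> `|g x - g c| <= e) ->
  `|\int[mu]_(x in `[0, 1]) (hat c r x * g x) - 2 * r ^+ 2 * g c| <= 2 * r ^+ 2 * e.
Proof.
move=> r0 c0 c1 cg H.
have [ih /(_ 0 1 (lexx _) ler01 (lexx _))] := hat_primitive c r.
have -> : hat_prim c r 1 = 2 * r ^+ 2 by exact: hat_prim_right.
have -> : hat_prim c r 0 = 0 by apply: hat_prim_left => //; lra.
rewrite subr0 => mass.
have ch : {within `[0, 1], continuous (hat c r)}.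
  exact: continuous_subspaceT (@hat_continuous c r).
have ihg : L1_01 (fun x => hat c r x * g x).
  exact: L1_01Ml ch (continuous_L1_01 cg).
have -> : \int[mu]_(x in `[0, 1]) (hat c r x * g x) - 2 * r ^+ 2 * g c =
    \int[mu]_(x in `[0, 1]) (hat c r x * g x - g c * hat c r x).
  rewrite RintegralB//; last exact: (L1_01Z (g c) ih).
  by rewrite RintegralZl// -mass (mulrC (g c)).
have -> : 2 * r ^+ 2 * e = e * \int[mu]_(t in `[0, 1]) `|hat c r t|.
  rewrite mulrC mass; congr (_ * _); apply: eq_Rintegral => x _.
  by rewrite ger0_norm// hat_ge0.
apply: le_Rintegral_norm => //.
  apply: eq_L1_01 (L1_01D ihg (L1_01Z (- g c) ih)) => x _ _; ring.
move=> x x0 x1; have [xc|xc] := ltP `|x - c| r; last by rewrite hat_out// mul0r mulr0 subrr normr0 mulr0.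
rewrite (mulrC (g c)) -mulrBr normrM mulrC ler_wpM2r//.
exact: H.
Qed.

(** The difference of two tents has zero mass, hence a compactly supported
    primitive. *)
Lemma hat_test_function (x y r : R) : 0 < r ->
  0 < x - r -> x + r < 1 -> 0 < y - r -> y + r < 1 ->
  C1c (fun z => hat_prim x r z - hat_prim y r z) /\
  derive1 (fun z => hat_prim x r z - hat_prim y r z) =
    (fun z => hat x r z - hat y r z).
Proof.
move=> r0 x0 x1 y0 y1.
have D (z : R) : is_derive z 1 (fun z => hat_prim x r z - hat_prim y r z) (hat x r z - hat y r z).
  exact: is_deriveB (is_derive_hat_prim x r z) (is_derive_hat_prim y r z).
have D1 : derive1 (fun z => hat_prim x r z - hat_prim y r z) =
    (fun z => hat x r z - hat y r z).
  by apply/funext => z; rewrite derive1E; have Dz := D z; exact: derive_val.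
split=> //; split.
- by move=> z; have Dz := D z; exact: ex_derive.
- by rewrite D1 => z; apply: cvgB; exact: hat_continuous.
exists (Num.min x y - r), (Num.max x y + r); split.
- by rewrite ltrBrDr lt_min; apply/andP; split; lra.
- by rewrite -ltrBrDr gt_max; apply/andP; split; lra.
move=> z; rewrite in_itv /= negb_and -!ltNge => /orP[].
  rewrite ltrBrDr lt_min => /andP[h1 h2].
  by rewrite !hat_prim_left ?subrr//; lra.
rewrite -ltrBrDr gt_max => /andP[h1 h2].
by rewrite !hat_prim_right ?subrr//; lra.
Qed.

(** Testing with the difference of narrow tents at two interior points
    identifies the values of [g] at these points; the end points follow by
    continuity. *)
Lemma du_bois_reymond (g : R -> R) : {within `[0, 1], continuous g} ->
  (forall phi, C1c phi -> \int[mu]_(x in `[0, 1]) (derive1 phi x * g x) = 0) ->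
  forall x, 0 <= x -> x <= 1 -> g x = g 0.
Proof.
move=> cg H.
have inside x y : 0 < x -> x < 1 -> 0 < y -> y < 1 -> g x = g y.
  move=> x0 x1 y0 y1; apply/eqP; rewrite -subr_eq0 -normr_le0.
  apply/ler_addgt0Pr => e e0; rewrite add0r.
  have e20 : 0 < e / 2 by lra.
  move/within_itvP : (cg) => cg'.
  have [dx dx0 Hx] := cg' x (ltW x0) (ltW x1) _ e20.
  have [dy dy0 Hy] := cg' y (ltW y0) (ltW y1) _ e20.
  pose r := Num.min dx (Num.min dy (Num.min x (Num.min (1 - x) (Num.min y (1 - y))))) / 2.
  have r0 : 0 < r by rewrite divr_gt0// !lt_min dx0 dy0 x0 y0 !subr_gt0 x1 y1.
  have : 2 * r <= Num.min dx (Num.min dy (Num.min x (Num.min (1 - x) (Num.min y (1 - y))))).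
    by rewrite /r mulrC divfK.
  rewrite !le_min => /and5P[rdx rdy rx rx1 /andP[ry ry1]].
  have [||||Cphi Dphi] := @hat_test_function x y r r0 _ _ _ _; try lra.
  have := H _ Cphi; rewrite Dphi => Hphi.
  have ax : `|\int[mu]_(z in `[0, 1]) (hat x r z * g z) - 2 * r ^+ 2 * g x| <= 2 * r ^+ 2 * (e / 2).
    apply: hat_average => //; try lra.
    by move=> z z0 z1 zx; apply/ltW/Hx => //; lra.
  have ay : `|\int[mu]_(z in `[0, 1]) (hat y r z * g z) - 2 * r ^+ 2 * g y| <= 2 * r ^+ 2 * (e / 2).
    apply: hat_average => //; try lra.
    by move=> z z0 z1 zx; apply/ltW/Hy => //; lra.
  have ih c : L1_01 (fun z => hat c r z * g z).
    by apply: L1_01Ml (continuous_L1_01 cg); exact: continuous_subspaceT (@hat_continuous c r).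
  have E : \int[mu]_(z in `[0, 1]) (hat x r z * g z) = \int[mu]_(z in `[0, 1]) (hat y r z * g z).
    apply/eqP; rewrite -subr_eq0 -RintegralB//; last 2 first.
      exact: ih.
      exact: ih.
    rewrite -[eqbRHS]Hphi; apply/eqP; apply: eq_Rintegral => z _; ring.
  rewrite E in ax.
  have r20 : 0 < 2 * r ^+ 2 by rewrite mulr_gt0// exprn_gt0.
  rewrite -(ler_pM2l r20) -[X in X * `|_|]gtr0_norm// -normrM.
  move: ax ay; set I := \int[mu]_(z in `[0, 1]) _.
  by rewrite !ler_norml => /andP[? ?] /andP[? ?]; apply/andP; split; lra.
have limit x : 0 <= x -> x <= 1 -> g x = g (1 / 2).
  move=> x0 x1; apply/eqP; rewrite -subr_eq0 -normr_le0.
  apply/ler_addgt0Pr => e e0; rewrite add0r.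
  move/within_itvP : (cg) => /(_ x x0 x1 _ e0)[d d0 Hd].
  pose s := Num.min (1 / 2) (d / 2).
  have s0 : 0 < s by rewrite lt_min; apply/andP; split; lra.
  have : s <= s by []; rewrite {2}/s le_min => /andP[s1 s2].
  have [y [y0 y1 yx]] : exists y, [/\ 0 < y, y < 1 & `|y - x| < d].
    have [x12|x12] := leP x (1 / 2).
      exists (x + s / 2); split; [lra|lra|].
      by rewrite ltr_norml; apply/andP; split; lra.
    exists (x - s / 2); split; [lra|lra|].
    by rewrite ltr_norml; apply/andP; split; lra.
  have h0 : 0 < 1 / 2 :> R by lra.
  have h1 : 1 / 2 < 1 :> R by lra.
  have <- : g y = g (1 / 2) := inside _ _ y0 y1 h0 h1.
  by rewrite distrC; apply/ltW/Hd => //; exact: ltW.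
by move=> x x0 x1; rewrite (limit x)// (limit 0).
Qed.

(** If [V] is an indefinite integral of [v], then [v] is also a weak derivative
    of [V], so [u - V] has weak derivative 0 and is constant. *)
Lemma weak_derivative_primitive u v : {within `[0, 1], continuous u} ->
  L1_01 v -> is_weak_derivative u v -> primitive u v.
Proof.
move=> cu iv wu.
pose V x := \int[mu]_(t in `[0, x]) v t.
have pV : primitive V v := integral_primitive iv.
have cV := primitive_continuous pV.
have cg : {within `[0, 1], continuous (fun x => u x - V x)}.
  by move=> x; apply: cvgB; [exact: cu|exact: cV].
have Hg : forall x, 0 <= x -> x <= 1 -> u x - V x = u 0 - V 0.
  apply: (@du_bois_reymond (fun x => u x - V x)) => // phi Cphi.
  have [ip _] := C1c_primitive Cphi.
  have iu := L1_01Ml cu ip; have iV := L1_01Ml cV ip.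
  have := wu _ Cphi; rewrite -(primitive_weak_derivative pV Cphi).
  rewrite !Rintegral_I01// => E.
  transitivity (\int[mu]_(x in `[0, 1]) (u x * derive1 phi x - V x * derive1 phi x)).
    by apply: eq_Rintegral => x _; ring.
  by rewrite RintegralB// E subrr.
have := primitiveD pV (primitive_cst (u 0 - V 0)).
apply: eq_primitive => x x0 x1 /=; first by rewrite -(Hg x)//; ring.
by rewrite addr0.
Qed.

End WeakDerivative.

(** * Logarithms of nonvanishing fields and winding *)

Section Winding.
Context {R : realType}.
Local Notation mu := (@lebesgue_measure R).
Implicit Types (f g v w : R -> R).

Lemma within_continuousV a b (q : R -> R) : {within `[a, b], continuous q} ->
  (forall x, a <= x -> x <= b -> q x != 0) ->
  {within `[a, b], continuous (fun x => (q x)^-1)}.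
Proof.
move=> /subspace_continuousP cq q0; apply/subspace_continuousP => x xab.
move: (xab); rewrite /= in_itv /= => /andP[ax xb].
by apply: cvgV; [exact: q0|exact: cq].
Qed.

Lemma within_continuousM a b f g : {within `[a, b], continuous f} ->
  {within `[a, b], continuous g} -> {within `[a, b], continuous (fun x => f x * g x)}.
Proof. by move=> cf cg x; apply: cvgM; [exact: cf|exact: cg]. Qed.

Lemma within_continuousD a b f g : {within `[a, b], continuous f} ->
  {within `[a, b], continuous g} -> {within `[a, b], continuous (fun x => f x + g x)}.
Proof. by move=> cf cg x; apply: cvgD; [exact: cf|exact: cg]. Qed.

(** With [z = f + i * g] and [log z] defined as the integral of [z' / z], the
    product [z * exp (- log z)] has zero derivative.  The functions [A] and [B]
    in the proof are the real and imaginary parts of this product. *)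
Lemma primitive_log f g v w : primitive f v -> primitive g w ->
  (forall x, 0 <= x -> x <= 1 -> 0 < f x ^+ 2 + g x ^+ 2) ->
  f 0 = 1 -> g 0 = 0 ->
  exists lam th : R -> R,
    [/\ primitive lam (fun x => (f x * v x + g x * w x) / (f x ^+ 2 + g x ^+ 2)),
        primitive th (fun x => (f x * w x - g x * v x) / (f x ^+ 2 + g x ^+ 2)),
        lam 0 = 0, th 0 = 0 &
        forall x, 0 <= x -> x <= 1 ->
          f x = expR (lam x) * cos (th x) /\ g x = expR (lam x) * sin (th x)].
Proof.
move=> pf pg q0 f0 g0.
have cf := primitive_continuous pf; have cg := primitive_continuous pg.
pose q x := f x ^+ 2 + g x ^+ 2.
have cq : {within `[0, 1], continuous (fun x => (q x)^-1)}.
  apply: within_continuousV; last by move=> x x0 x1; rewrite gt_eqF// q0.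
  by apply: within_continuousD; apply: within_continuousM.
have [[iv _] [iw _]] := (pf, pg).
have iq (h z : R -> R) : {within `[0, 1], continuous h} -> L1_01 z -> L1_01 (fun x => h x * z x / q x).
  move=> ch iz; apply: eq_L1_01 (L1_01Ml cq (L1_01Ml ch iz)) => x _ _.
  by rewrite mulrC.
have plam : primitive (fun x => \int[mu]_(t in `[0, x]) ((f t * v t + g t * w t) / q t))
    (fun x => (f x * v x + g x * w x) / q x).
  apply: integral_primitive; apply: eq_L1_01 (L1_01D (iq _ _ cf iv) (iq _ _ cg iw)).
  by move=> x _ _; rewrite mulrDl.
have pth : primitive (fun x => \int[mu]_(t in `[0, x]) ((f t * w t - g t * v t) / q t))
    (fun x => (f x * w x - g x * v x) / q x).
  apply: integral_primitive.
  apply: eq_L1_01 (L1_01D (iq _ _ cf iw) (L1_01Z (-1) (iq _ _ cg iv))).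
  by move=> x _ _; ring.
move: plam pth; set lam := fun x : R => Rintegral _ _ _; set th := fun x : R => Rintegral _ _ _.
move=> plam pth; exists lam, th.
have lam0 : lam 0 = 0 by rewrite /lam set_itv1 Rintegral_set1.
have th0 : th 0 = 0 by rewrite /th set_itv1 Rintegral_set1.
split=> //.
have pE := primitive_comp (@is_derive_expR R) (@continuous_expR R) (primitiveZ (-1) plam).
have pC := primitive_comp (@is_derive_cos R) (F' := fun x => - sin x) _ pth.
have pS := primitive_comp (@is_derive_sin R) (@continuous_cos R) pth.
have {}pC : primitive (cos \o th) (fun x => - sin (th x) * ((f x * w x - g x * v x) / q x)).
  by apply: pC => x; apply: cvgN; exact: continuous_sin.
have A := primitive_zero_const (primitiveM pE (primitiveD (primitiveM pf pC) (primitiveM pg pS))).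
have B := primitive_zero_const (primitiveM pE (primitiveB (primitiveM pg pC) (primitiveM pf pS))).
move=> x x0 x1.
have {}A : expR (- lam x) * (f x * cos (th x) + g x * sin (th x)) = 1.
  have := A _ x x0 x1; rewrite /= lam0 th0 f0 g0 mulr0 expR0 cos0 !mul1r mul0r addr0 mulN1r; apply.
  move=> y y0 y1; have := q0 y y0 y1; rewrite -/(q y) => /lt0r_neq0 qy.
  rewrite /q in qy *; field.
  exact: qy.
have {}B : expR (- lam x) * (g x * cos (th x) - f x * sin (th x)) = 0.
  have := B _ x x0 x1; rewrite /= lam0 th0 f0 g0 mulr0 expR0 sin0 !mul1r mul0r subr0 mulN1r; apply.
  move=> y y0 y1; have := q0 y y0 y1; rewrite -/(q y) => /lt0r_neq0 qy.
  rewrite /q in qy *; field.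
  exact: qy.
have eE : expR (lam x) * expR (- lam x) = 1 by rewrite -expRD subrr expR0.
have {}A : f x * cos (th x) + g x * sin (th x) = expR (lam x).
  by rewrite -[RHS]mulr1 -A mulrA eE mul1r.
have {}B : g x * cos (th x) - f x * sin (th x) = 0.
  by rewrite -[LHS]mul1r -eE -mulrA B mulr0.
have cs := cos2Dsin2 (th x).
rewrite -A; split.
  have -> : (f x * cos (th x) + g x * sin (th x)) * cos (th x) =
      f x * (cos (th x) ^+ 2 + sin (th x) ^+ 2)
      + sin (th x) * (g x * cos (th x) - f x * sin (th x)) by ring.
  by rewrite cs B; ring.
have -> : (f x * cos (th x) + g x * sin (th x)) * sin (th x) =
    g x * (cos (th x) ^+ 2 + sin (th x) ^+ 2)
    - cos (th x) * (g x * cos (th x) - f x * sin (th x)) by ring.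
by rewrite cs B; ring.
Qed.

(** The total change of angle is [k], not divided by [2 * pi]. *)
Definition has_winding (u : R -> R * R) (k : R) : Prop :=
  exists phi : R -> R, [/\ {within `[0, 1], continuous phi}, phi 0 = 0, phi 1 = k &
    forall x, 0 <= x -> x <= 1 ->
      exists2 r, 0 < r & u x = (r * cos (phi x), r * sin (phi x))].

(** The difference [d] of the two angles satisfies [cos d > 0] and [d 0 = 0], so
    it remains in the interval from [- pi / 2] to [pi / 2]; at the end the two
    fields agree, so [sin (d 1) = 0]. *)
Lemma winding_unique (u u' : R -> R * R) (k k' : R) :
  has_winding u k -> has_winding u' k' -> u 1 = u' 1 ->
  (forall x, 0 <= x -> x <= 1 -> 0 < (u x).1 * (u' x).1 + (u x).2 * (u' x).2) ->
  k = k'.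
Proof.
move=> [phi [cphi phi0 phi1 Hphi]] [psi [cpsi psi0 psi1 Hpsi]] uu' pos.
pose d x := phi x - psi x.
have cd : {within `[0, 1], continuous d}.
  by move=> x; apply: cvgB; [exact: cphi|exact: cpsi].
have cosd x : 0 <= x -> x <= 1 -> 0 < cos (d x).
  move=> x0 x1; have := pos x x0 x1.
  have [r r0 ->] := Hphi x x0 x1; have [s s0 ->] := Hpsi x x0 x1.
  rewrite /= /d cosB => h; rewrite -(pmulr_rgt0 _ (mulr_gt0 r0 s0)).
  by apply: lt_le_trans h _; rewrite le_eqVlt; apply/orP; left; apply/eqP; ring.
have d0 : d 0 = 0 by rewrite /d phi0 psi0 subrr.
have pi2 : 0 < pi / 2 :> R by rewrite divr_gt0// pi_gt0.
have dlt : d 1 < pi / 2.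
  rewrite ltNge; apply/negP => h.
  have mid : Num.min (d 0) (d 1) <= pi / 2 <= Num.max (d 0) (d 1).
    by rewrite d0 ge_min le_max h (ltW pi2) orbT.
  have [c] := IVT (@ler01 R) cd mid.
  rewrite in_itv /= => /andP[c0 c1] dc.
  by have := cosd c c0 c1; rewrite dc cos_pihalf ltxx.
have dgt : - (pi / 2) < d 1.
  rewrite ltNge; apply/negP => h.
  have mid : Num.min (d 0) (d 1) <= - (pi / 2) <= Num.max (d 0) (d 1).
    by rewrite d0 ge_min le_max h oppr_le0 (ltW pi2) orbT.
  have [c] := IVT (@ler01 R) cd mid.
  rewrite in_itv /= => /andP[c0 c1] dc.
  by have := cosd c c0 c1; rewrite dc cosN cos_pihalf ltxx.
have sd : sin (d 1) = 0.
  move: uu'; have [r r0 ->] := Hphi 1 ler01 (lexx _); have [s s0 ->] := Hpsi 1 ler01 (lexx _).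
  move=> [h1 h2]; rewrite /d sinB.
  apply: (mulfI (lt0r_neq0 r0)); rewrite mulr0.
  have -> : r * (sin (phi 1) * cos (psi 1) - cos (phi 1) * sin (psi 1)) =
    r * sin (phi 1) * cos (psi 1) - r * cos (phi 1) * sin (psi 1) by ring.
  by rewrite h1 h2; ring.
have : d 1 = 0.
  apply: sin_inj; rewrite ?sin0// in_itv /=.
    by rewrite !ltW.
  by rewrite oppr_le0 !ltW.
by rewrite /d phi1 psi1 => /eqP; rewrite subr_eq0 => /eqP.
Qed.

End Winding.

(** * Sobolev bound and pointwise energy bounds *)

Section Energy.
Context {R : realType}.
Local Notation mu := (@lebesgue_measure R).

(** The chosen weak derivative is one to which the calculus applies. *)
Lemma H1_wderiv (u : R -> R) : H1 u ->
  square_integrable (wderiv u) /\ primitive u (wderiv u).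
Proof.
move=> [cu ex].
have [sv wv] : [set v | square_integrable v /\ is_weak_derivative u v] (wderiv u).
  by rewrite /wderiv; apply: xgetPex; case: ex => v Hv; exists v.
by split=> //; apply: weak_derivative_primitive => //; exact: square_integrable_L1.
Qed.

Lemma H1B (u v : R -> R) : H1 u -> H1 v -> H1 (fun x => u x - v x).
Proof.
move=> Hu Hv; have [su pu] := H1_wderiv Hu; have [sv pv] := H1_wderiv Hv.
have puv := primitiveB pu pv.
split; first exact: primitive_continuous puv.
exists (fun x => wderiv u x - wderiv v x); split.
  exact: square_integrableB.
exact: primitive_weak_derivative.
Qed.

(** [|f x|] is at most the integral of [|w|], and
    [|w| <= (w ^+ 2 + e ^+ 2) / (2 * e)]. *)
Lemma sup_lt_of_L2_derivative (f w : R -> R) (e : R) : 0 < e -> f 0 = 0 ->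
  primitive f w -> square_integrable w ->
  \int[mu]_(x in `[0, 1]) (w x ^+ 2) < e ^+ 2 ->
  forall x, 0 <= x -> x <= 1 -> `|f x| < e.
Proof.
move=> e0 f0 pf sw we x x0 x1.
have [iw _] := pf.
have iw2 := square_integrable_L1sqr sw.
have im : L1_01 (fun t => (2 * e)^-1 * w t ^+ 2 + e / 2).
  exact: L1_01D (L1_01Z _ iw2) (L1_01_cst _).
rewrite (primitive_subr0 pf)// f0 add0r.
apply: (@le_lt_trans _ _ (\int[mu]_(t in `[0, 1]) ((2 * e)^-1 * w t ^+ 2 + e / 2))).
  apply: (le_trans (le_normr_Rintegral _ _)) => //.
    exact: L1_01_sub iw.
  rewrite (Rintegral_chasles (lexx 0) x0 x1 _ im)//.
  rewrite -[leLHS]addr0; apply: lerD; last first.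
    apply: Rintegral_ge0 => t _.
    by apply: addr_ge0; [apply: mulr_ge0; [rewrite invr_ge0; lra|exact: sqr_ge0]|lra].
  apply: le_Rintegral => //.
  - by apply: integrable_norm; exact: L1_01_sub iw.
  - exact: L1_01_sub im.
  move=> t _.
  have -> : (2 * e)^-1 * w t ^+ 2 + e / 2 = (`|w t| ^+ 2 + e ^+ 2) / (2 * e).
    by rewrite -normrX ger0_norm ?sqr_ge0//; field; rewrite gt_eqF.
  rewrite ler_pdivlMr; last lra.
  rewrite -subr_ge0.
  have -> : `|w t| ^+ 2 + e ^+ 2 - `|w t| * (2 * e) = (`|w t| - e) ^+ 2 by ring.
  exact: sqr_ge0.
rewrite RintegralD//; last 2 first.
  exact: (L1_01Z _ iw2).
  exact: (L1_01_cst (e / 2)).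
have -> : \int[mu]_(t in `[0, 1]) (e / 2) = e / 2.
  by rewrite Rintegral_cst// /= lebesgue_measure_itv /= lte_fin ltr01 /= subr0 mulr1.
rewrite RintegralZl//.
have : (2 * e)^-1 * \int[mu]_(x0 in `[0, 1]) w x0 ^+ 2 < (2 * e)^-1 * e ^+ 2.
  by rewrite ltr_pM2l// invr_gt0; lra.
have -> : (2 * e)^-1 * e ^+ 2 = e / 2 by field; rewrite gt_eqF.
by move=> ?; lra.
Qed.

Lemma H1norm_sup (u : R -> R * R) (e : R) : 0 < e -> H1vec u -> u 0 = (0, 0) ->
  H1norm u < e ->
  forall x, 0 <= x -> x <= 1 -> `|(u x).1| < e /\ `|(u x).2| < e.
Proof.
move=> e0 [H1f H1g] u0 ue.
have [sv pf] := H1_wderiv H1f; have [sw pg] := H1_wderiv H1g.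
have [f0 g0] : fst_of u 0 = 0 /\ snd_of u 0 = 0 by rewrite /fst_of /snd_of u0.
have i2 (h : R -> R) : {within `[0, 1], continuous h} -> L1_01 (fun x => h x ^+ 2).
  by move=> ch; apply: continuous_L1_01; exact: within_continuousM.
have iD := L1_01D (L1_01D (i2 _ (primitive_continuous pf)) (i2 _ (primitive_continuous pg)))
  (L1_01D (square_integrable_L1sqr sv) (square_integrable_L1sqr sw)).
move: ue; rewrite /H1norm Rintegral_I01//.
set I := Rintegral _ _ _ => ue.
have I0 : 0 <= I.
  by apply: Rintegral_ge0 => x _; rewrite !addr_ge0// sqr_ge0.
have Ie : I < e ^+ 2.
  by rewrite -(sqr_sqrtr I0) ltr_pXn2r// nnegrE ?sqrtr_ge0// ltW.
have Iv : \int[mu]_(x in `[0, 1]) (wderiv (fst_of u) x ^+ 2) < e ^+ 2.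
  apply: le_lt_trans Ie; apply: le_Rintegral => //; first exact: square_integrable_L1sqr.
  move=> x _; have := sqr_ge0 (fst_of u x); have := sqr_ge0 (snd_of u x).
  by have := sqr_ge0 (wderiv (snd_of u) x); lra.
have Iw : \int[mu]_(x in `[0, 1]) (wderiv (snd_of u) x ^+ 2) < e ^+ 2.
  apply: le_lt_trans Ie; apply: le_Rintegral => //; first exact: square_integrable_L1sqr.
  move=> x _; have := sqr_ge0 (fst_of u x); have := sqr_ge0 (snd_of u x).
  by have := sqr_ge0 (wderiv (fst_of u) x); lra.
move=> x x0 x1; split.
  exact: (sup_lt_of_L2_derivative e0 f0 pf sv Iv).
exact: (sup_lt_of_L2_derivative e0 g0 pg sw Iw).
Qed.

(** The difference of the two sides is a square divided by [4 * eps].  Here [p]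
    stands for [|u| ^+ 2 - 1] and [m] for the derivative of [|u|]; the sign [s]
    is chosen according to whether the modulus decreases or increases. *)
Lemma modica_mortola_pointwise (eps p m s : R) : 0 < eps -> s ^+ 2 = 1 ->
  s * (Num.sqrt 2 / 2) * (p * m) <= eps / 2 * m ^+ 2 + (4 * eps)^-1 * p ^+ 2.
Proof.
move=> e0 s2.
have r2 : Num.sqrt 2 ^+ 2 = 2 :> R by rewrite sqr_sqrtr.
rewrite -subr_ge0.
have -> : eps / 2 * m ^+ 2 + (4 * eps)^-1 * p ^+ 2 - s * (Num.sqrt 2 / 2) * (p * m)
  = (4 * eps)^-1 * (Num.sqrt 2 * eps * m - s * p) ^+ 2.
  have -> : (Num.sqrt 2 * eps * m - s * p) ^+ 2 =
    Num.sqrt 2 ^+ 2 * eps ^+ 2 * m ^+ 2 - 2 * s * Num.sqrt 2 * eps * m * p + s ^+ 2 * p ^+ 2 by ring.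
  by rewrite r2 s2; field; rewrite gt_eqF.
by rewrite mulr_ge0 ?sqr_ge0// invr_ge0; lra.
Qed.

(** Here [j] is the twist density, [q = |u| ^+ 2] and [j / q] the derivative of
    the angle.  For [q = 1] this is the tangent line inequality
    [(j - c) ^+ 2 >= 2 * k * (j - c) - k ^+ 2].  In general the error is
    [t * p * j] with [t = k / q] and [p = q - 1]; since
    [j = (j - c - k) + (k + c)], it is absorbed by completing two squares, at
    the price of the multiple of [p ^+ 2] that the double-well term provides,
    and of [sg]. *)
Lemma twist_pointwise (L eps eta sg j c k q Q : R) :
  0 < L -> 0 < eps -> 0 < sg -> 0 < q ->
  (k / q) ^+ 2 * (L / 2 + L ^+ 2 * (k + c) ^+ 2 / (4 * sg)) <= Q ->
  4 * eps * Q <= eta ->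
  L / 2 * (2 * k * (j / q - c) - k ^+ 2) - sg <=
  eta * ((4 * eps)^-1 * (q - 1) ^+ 2) + L / 2 * (j - c) ^+ 2.
Proof.
move=> L0 e0 s0 q0 HQ Heta; set W := k + c in HQ *.
pose t := k / q; pose z := j - c - k; pose p := q - 1.
have Hp : (t ^+ 2 * (L / 2 + L ^+ 2 * W ^+ 2 / (4 * sg))) * p ^+ 2 <= eta * ((4 * eps)^-1 * p ^+ 2).
  rewrite [leRHS]mulrA ler_wpM2r ?sqr_ge0//; apply: (le_trans HQ).
  by rewrite ler_pdivlMr; lra.
have kq : k = t * q by rewrite /t divfK// gt_eqF.
rewrite -/p; apply: le_trans (lerD Hp (lexx _)); rewrite -subr_ge0.
suff -> : t ^+ 2 * (L / 2 + L ^+ 2 * W ^+ 2 / (4 * sg)) * p ^+ 2 + L / 2 * (j - c) ^+ 2 -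
  (L / 2 * (2 * k * (j / q - c) - k ^+ 2) - sg) =
  L / 2 * (z + t * p) ^+ 2 + (4 * sg)^-1 * (L * t * W * p + 2 * sg) ^+ 2.
  by rewrite addr_ge0// mulr_ge0 ?sqr_ge0// ?invr_ge0; lra.
rewrite /z /p /W kq; field.
by rewrite !gt_eqF.
Qed.

End Energy.

(** * Energy of a field with a small modulus and a given winding *)

Section Gap.
Context {R : realType}.
Local Notation mu := (@lebesgue_measure R).

(** The continuous factors are bounded and the derivatives square integrable,
    so the energy of an [H^1] field is finite. *)
Lemma density_L1 (L : R) (N : nat) (eps : R) (u : R -> R * R) : H1vec u ->
  L1_01 (energy_density L N eps u).
Proof.
move=> [H1f H1g].
have [sv pf] := H1_wderiv H1f; have [sw pg] := H1_wderiv H1g.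
have cf := primitive_continuous pf; have cg := primitive_continuous pg.
set f := fst_of u in pf cf sv *; set g := snd_of u in pg cg sw *.
set v := wderiv f in pf sv; set w := wderiv g in pg sw.
pose c : R := 2 * pi * N%:R.
have [[iv _] [iw _]] := (pf, pg).
have ivv := square_integrable_L1M sv sv.
have iww := square_integrable_L1M sw sw.
have ivw := square_integrable_L1M sv sw.
have ipot : L1_01 (fun x => (f x ^+ 2 + g x ^+ 2 - 1) ^+ 2).
  apply: continuous_L1_01.
  have cp : {within `[0, 1], continuous (fun x => f x * f x + g x * g x - 1)}.
    apply: within_continuousD; last by apply: continuous_subspaceT => ?; exact: cvg_cst.
    by apply: within_continuousD; exact: within_continuousM.
  exact: within_continuousM.
have i1 := L1_01D (L1_01D (L1_01Z (eps / 2) ivv) (L1_01Z (eps / 2) iww)) (L1_01Z (4 * eps)^-1 ipot).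
have i2 := L1_01D (L1_01Ml cf (L1_01Ml cf iww)) (L1_01Ml cg (L1_01Ml cg ivv)).
have i3 := L1_01D i2 (L1_01Z (- 2) (L1_01Ml cf (L1_01Ml cg ivw))).
have i4 := L1_01D (L1_01Z (- 2 * c) (L1_01Ml cf iw)) (L1_01Z (2 * c) (L1_01Ml cg iv)).
have i5 := L1_01Z (L / 2) (L1_01D i3 (L1_01D i4 (L1_01_cst (c ^+ 2)))).
apply: eq_L1_01 (L1_01D i1 i5) => x _ _.
rewrite /energy_density -/f -/g -/v -/w -/c /=; ring.
Qed.

Lemma energy_Rintegral (L : R) (N : nat) (eps : R) (u : R -> R * R) : H1vec u ->
  energy L N eps u = (\int[mu]_(x in `[0, 1]) energy_density L N eps u x)%:E.
Proof.
move=> Hu; have iD := density_L1 L N eps Hu.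
rewrite -Rintegral_I01// /Rintegral fineK//.
by apply: integrable_fin_num; [exact: measurable_itv|apply/integrable_I01P].
Qed.

(** The primitive [r - r ^+ 3 / 3] of [1 - r ^+ 2], at [r = expR l]. *)
Definition modica_mortola_potential (l : R) : R := expR l - expR (3 * l) / 3.

Lemma modica_mortola_potential_primitive (lam dlam : R -> R) : primitive lam dlam ->
  primitive (fun x => modica_mortola_potential (lam x))
    (fun x => expR (lam x) * (1 - expR (lam x) ^+ 2) * dlam x).
Proof.
move=> plam.
have p1 := primitive_comp (@is_derive_expR R) (@continuous_expR R) plam.
have p3 := primitive_comp (@is_derive_expR R) (@continuous_expR R) (primitiveZ 3 plam).
apply: eq_primitive (primitiveB p1 (primitiveZ (1 / 3) p3)) => x _ _ /=.
  by rewrite /modica_mortola_potential; field.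
have -> : expR (3 * lam x) = expR (lam x) ^+ 3 by rewrite -expRM_natl.
by field.
Qed.

(** The fraction [eta] of the double-well term goes to the twist, the rest to
    the Modica--Mortola inequality.  In the variables [rho = expR lam] and
    [theta], the left-hand side is the derivative of a function of [lam],
    [theta] and the position. *)
Lemma density_lower_bound (L eps eta sg dl k c s f g v w rho : R) :
  0 < L -> 0 < eps -> 0 < sg -> 0 < dl -> 0 <= eta -> eta <= 1 -> s ^+ 2 = 1 ->
  0 < rho -> rho ^+ 2 = f ^+ 2 + g ^+ 2 -> dl ^+ 2 <= f ^+ 2 + g ^+ 2 ->
  4 * eps * ((k / dl ^+ 2) ^+ 2 * (L / 2 + L ^+ 2 * (k + c) ^+ 2 / (4 * sg))) <= eta ->
  (1 - eta) * (s * (Num.sqrt 2 / 2)) *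
      (rho * (1 - rho ^+ 2) * ((f * v + g * w) / (f ^+ 2 + g ^+ 2)))
    + (L / 2 * (2 * k * ((f * w - g * v) / (f ^+ 2 + g ^+ 2) - c) - k ^+ 2) - sg)
  <= eps / 2 * (v ^+ 2 + w ^+ 2) + (4 * eps)^-1 * (f ^+ 2 + g ^+ 2 - 1) ^+ 2
     + L / 2 * (f * w - g * v - c) ^+ 2.
Proof.
move=> L0 e0 sg0 dl0 eta0 eta1 s2 rho0 rhoq.
rewrite -rhoq; set q := rho ^+ 2; set j := f * w - g * v => dlq Heps.
have q0 : 0 < q by rewrite exprn_gt0.
have dl20 : 0 < dl ^+ 2 by rewrite exprn_gt0.
set m := (f * v + g * w) / rho.
have -> : rho * (1 - q) * ((f * v + g * w) / q) = - ((q - 1) * m).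
  by rewrite /q /m; field; rewrite gt_eqF.
have mm : m ^+ 2 <= v ^+ 2 + w ^+ 2.
  rewrite /m expr_div_n ler_pdivrMr ?exprn_gt0// rhoq -subr_ge0.
  have -> : (v ^+ 2 + w ^+ 2) * (f ^+ 2 + g ^+ 2) - (f * v + g * w) ^+ 2 = j ^+ 2.
    by rewrite /j; ring.
  exact: sqr_ge0.
have s2' : (- s) ^+ 2 = 1 by rewrite sqrrN.
have MM := modica_mortola_pointwise (q - 1) m e0 s2'.
set Q := (k / dl ^+ 2) ^+ 2 * _ in Heps.
have HQ : (k / q) ^+ 2 * (L / 2 + L ^+ 2 * (k + c) ^+ 2 / (4 * sg)) <= Q.
  apply: ler_wpM2r.
    apply: addr_ge0; first lra.
    by apply: divr_ge0; [rewrite mulr_ge0 ?sqr_ge0|lra].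
  rewrite !expr_div_n ler_wpM2l ?sqr_ge0// lef_pV2 ?posrE ?exprn_gt0//.
  by rewrite ler_pXn2r// nnegrE ltW.
have TT := twist_pointwise j L0 e0 sg0 q0 HQ Heps.
have e1 : 0 <= 1 - eta by lra.
have := ler_wpM2l e1 MM.
have kin : (1 - eta) * (eps / 2 * m ^+ 2) <= eps / 2 * (v ^+ 2 + w ^+ 2).
  apply: (@le_trans _ _ (eps / 2 * m ^+ 2)); last by rewrite ler_wpM2l//; lra.
  have E : 0 <= eps / 2 * m ^+ 2 by apply: mulr_ge0; [lra|exact: sqr_ge0].
  by have := mulr_ge0 eta0 E; lra.
move: TT kin; set P := (4 * eps)^-1 * _; set J := L / 2 * (j - c) ^+ 2.
set T := L / 2 * _ - sg; set V := eps / 2 * (v ^+ 2 + w ^+ 2); set K := eps / 2 * _.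
have -> : (1 - eta) * (- s * (Num.sqrt 2 / 2) * ((q - 1) * m)) =
  (1 - eta) * (s * (Num.sqrt 2 / 2)) * - ((q - 1) * m) by ring.
set X := (1 - eta) * _ * _.
move=> h1 h2 h3; rewrite mulrDr in h3; lra.
Qed.

(** The modulus decreases from 1 to less than [2 * dl] between 0 and [x0]
    and increases back to 1 between [x0] and 1: the lower bound for the density is
    integrated with [s = -1] on the first interval and with [s = 1] on the
    second one.  The terms in [theta] add up over both intervals to
    [L / 2 * k ^+ 2], since [theta 1 - c = k]. *)
Lemma energy_gap (L : R) (N : nat) (alpha eps eta sg dl k x0 : R) (u : R -> R * R) :
  0 < L -> 0 < eps -> 0 < sg -> 0 < dl -> 0 <= eta -> eta <= 1 ->
  4 * eps * ((k / dl ^+ 2) ^+ 2 *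
    (L / 2 + L ^+ 2 * (k + 2 * pi * N%:R) ^+ 2 / (4 * sg))) <= eta ->
  admissible alpha u -> has_winding u (k + 2 * pi * N%:R) ->
  (forall x, 0 <= x -> x <= 1 -> dl ^+ 2 <= (u x).1 ^+ 2 + (u x).2 ^+ 2) ->
  0 <= x0 -> x0 <= 1 -> (u x0).1 ^+ 2 + (u x0).2 ^+ 2 < (2 * dl) ^+ 2 ->
  (((1 - eta) * (Num.sqrt 2 * (2 / 3 - 2 * dl)) + L / 2 * k ^+ 2 - sg)%:E
    <= energy L N eps u)%E.
Proof.
move=> L0 e0 sg0 dl0 eta0 eta1; set c := 2 * pi * N%:R => Heps [Hu u0 u1] Wu udl x00 x01 ux0.
have [H1f H1g] := Hu.
have [sv pf] := H1_wderiv H1f; have [sw pg] := H1_wderiv H1g.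
have iD := density_L1 L N eps Hu.
rewrite energy_Rintegral// lee_fin.
set f := fst_of u in pf sv *; set g := snd_of u in pg sw *.
set v := wderiv f in pf sv *; set w := wderiv g in pg sw *.
have q0 x : 0 <= x -> x <= 1 -> 0 < f x ^+ 2 + g x ^+ 2.
  by move=> x_0 x_1; apply: lt_le_trans (udl x x_0 x_1); rewrite exprn_gt0.
have f0 : f 0 = 1 by rewrite /f /fst_of u0.
have g0 : g 0 = 0 by rewrite /g /snd_of u0.
have [lam [th [plam pth lam0 th0 fg]]] := primitive_log pf pg q0 f0 g0.
have uE x : u x = (f x, g x) by rewrite /f /g /fst_of /snd_of; case: (u x).
have Wth : has_winding u (th 1).
  exists th; split=> //; first exact: primitive_continuous pth.
  move=> x x_0 x_1; exists (expR (lam x)); first exact: expR_gt0.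
  by rewrite uE; have [-> ->] := fg x x_0 x_1.
have th1 : th 1 = k + c.
  apply: (winding_unique Wth Wu erefl) => x x_0 x_1.
  by rewrite uE /= -!expr2; exact: (q0 x x_0 x_1).
have rho2 x : 0 <= x -> x <= 1 -> expR (lam x) ^+ 2 = f x ^+ 2 + g x ^+ 2.
  move=> x_0 x_1; have [-> ->] := fg x x_0 x_1.
  by rewrite !exprMn -mulrDr cos2Dsin2 mulr1.
have lam1 : expR (lam 1) = 1.
  apply/eqP; rewrite -(@eqrXn2 _ 2)// ?expR_ge0// expr1n rho2//.
  by rewrite /f /g /fst_of /snd_of u1 /= cos2Dsin2.
have rx0 : expR (lam x0) < 2 * dl.
  rewrite -(@ltr_pXn2r _ 2)// ?nnegrE ?expR_ge0//; last by lra.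
  by rewrite rho2.
pose F s x := (1 - eta) * (s * (Num.sqrt 2 / 2)) * modica_mortola_potential (lam x)
   + (L / 2 * (2 * k * (th x - c * x) - k ^+ 2 * x) - sg * x).
have pF s : primitive (F s) (fun x => (1 - eta) * (s * (Num.sqrt 2 / 2)) *
      (expR (lam x) * (1 - expR (lam x) ^+ 2) * ((f x * v x + g x * w x) / (f x ^+ 2 + g x ^+ 2)))
    + (L / 2 * (2 * k * ((f x * w x - g x * v x) / (f x ^+ 2 + g x ^+ 2) - c) - k ^+ 2) - sg)).
  have p1 := primitiveZ ((1 - eta) * (s * (Num.sqrt 2 / 2))) (modica_mortola_potential_primitive plam).
  have p2 := primitiveZ (L / 2) (primitiveB (primitiveZ (2 * k) (primitiveB pth
     (primitiveZ c primitive_id))) (primitiveZ (k ^+ 2) primitive_id)).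
  have := primitiveD p1 (primitiveB p2 (primitiveZ sg primitive_id)).
  by apply: eq_primitive => x _ _ //=; rewrite !mulr1.
have step s x y : s ^+ 2 = 1 -> 0 <= x -> x <= y -> y <= 1 ->
    F s y - F s x <= \int[mu]_(t in `[x, y]) energy_density L N eps u t.
  move=> s2 x_0 xy y1; have [iF HF] := pF s; rewrite HF//.
  apply: le_Rintegral => //; [exact: L1_01_sub iF|exact: L1_01_sub iD|].
  move=> t; rewrite /= in_itv /= => /andP[xt ty].
  have t0 : 0 <= t by lra.
  have t1 : t <= 1 by lra.
  apply: (density_lower_bound (dl := dl)) => //.
  - exact: expR_gt0.
  - exact: rho2.
  - exact: udl.
have sN1 : (-1 : R) ^+ 2 = 1 by rewrite sqrrN expr1n.
have s1 : (1 : R) ^+ 2 = 1 by rewrite expr1n.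
have left_ := step (-1) 0 x0 sN1 (lexx _) x00 x01.
have right_ := step 1 x0 1 s1 x00 x01 (lexx _).
rewrite (Rintegral_chasles (lexx 0) x00 x01 (lexx _) iD).
apply: le_trans (lerD left_ right_).
have G0 : modica_mortola_potential (lam 0) = 2 / 3.
  by rewrite /modica_mortola_potential lam0 mulr0 expR0; field.
have G1 : modica_mortola_potential (lam 1) = 2 / 3.
  rewrite /modica_mortola_potential; have -> : expR (3 * lam 1) = expR (lam 1) ^+ 3 by rewrite -expRM_natl.
  by rewrite lam1; field.
have Gx : modica_mortola_potential (lam x0) <= 2 * dl.
  by rewrite /modica_mortola_potential; have := expR_gt0 (3 * lam x0); lra.
rewrite /F G0 G1 th1 th0 -subr_ge0.
set G := modica_mortola_potential _ in Gx *.
set lhs := (X in 0 <= X).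
have -> : lhs = (1 - eta) * Num.sqrt 2 * (2 * dl - G) by rewrite /lhs; field.
by rewrite mulr_ge0 ?mulr_ge0 ?sqrtr_ge0 ?subr_ge0.
Qed.

End Gap.

(** * Conservation of the winding along a path *)

Section Path.
Context {R : realType}.

Lemma nonvanishing_has_winding (alpha : R) (u : R -> R * R) : admissible alpha u ->
  (forall x, 0 <= x -> x <= 1 -> 0 < (u x).1 ^+ 2 + (u x).2 ^+ 2) ->
  exists k, has_winding u k.
Proof.
move=> [[H1f H1g] u0 _] upos.
have [_ pf] := H1_wderiv H1f; have [_ pg] := H1_wderiv H1g.
have f0 : fst_of u 0 = 1 by rewrite /fst_of u0.
have g0 : snd_of u 0 = 0 by rewrite /snd_of u0.
have [lam [th [_ pth _ th0 fg]]] := primitive_log pf pg upos f0 g0.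
exists (th 1), th; split=> //; first exact: primitive_continuous pth.
move=> x x0 x1; exists (expR (lam x)); first exact: expR_gt0.
by have [<- <-] := fg x x0 x1; rewrite /fst_of /snd_of; case: (u x).
Qed.

(** The angle of a competitor is a lifting, with the prescribed end value. *)
Lemma is_u_eps_M_winding (L : R) (N M : nat) (alpha rho0 eps : R) (u v : R -> R * R) :
  0 < rho0 -> is_u_eps_M L N alpha rho0 eps M u ->
  (forall x, x \in `[0, 1] -> v x = u x) ->
  has_winding v (2 * pi * M%:R + alpha) /\
  (forall x, 0 <= x -> x <= 1 -> rho0 ^+ 2 <= (v x).1 ^+ 2 + (v x).2 ^+ 2).
Proof.
move=> rho0_gt0 [rho [th [[[[_ _ _ rhoge] [[cth _] th0 th1]] _] upolar]]] vu.
have vE x : 0 <= x -> x <= 1 ->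
    rho0 <= rho x /\ v x = (rho x * cos (th x), rho x * sin (th x)).
  move=> x0 x1; have x01 : x \in `[0, 1] by rewrite in_itv /= x0.
  by split; [exact: rhoge|rewrite vu// upolar].
split.
  exists th; split=> // x x0 x1; have [r0 ->] := vE x x0 x1.
  by exists (rho x) => //; exact: lt_le_trans r0.
move=> x x0 x1; have [r0 ->] := vE x x0 x1.
rewrite /= !exprMn -mulrDr cos2Dsin2 mulr1 ler_pXn2r// nnegrE; first exact: ltW.
by apply: le_trans r0; exact: ltW.
Qed.

(** The [H^1] norm controls the supremum because all fields of the path start at
    the same point. *)
Lemma path_uniformly_close (alpha : R) (gamma : R -> R -> R * R) (t e : R) :
  continuous_path alpha gamma -> 0 <= t -> t <= 1 -> 0 < e ->
  exists2 d : R, 0 < d & forall s, 0 <= s -> s <= 1 -> `|s - t| < d ->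
    forall x, 0 <= x -> x <= 1 ->
      `|(gamma s x).1 - (gamma t x).1| < e /\ `|(gamma s x).2 - (gamma t x).2| < e.
Proof.
move=> [adm cont] t0 t1 e0.
have t01 : t \in `[0, 1] by rewrite in_itv /= t0.
have [d d0 Hd] := cont t t01 e e0; exists d => // s s0 s1 st x x0 x1.
have s01 : s \in `[0, 1] by rewrite in_itv /= s0.
have [[Hs1 Hs2] us0 _] := adm s s01; have [[Ht1 Ht2] ut0 _] := adm t t01.
apply: (@H1norm_sup R (fun x => gamma s x - gamma t x) e e0) => //.
- by split; exact: H1B.
- by rewrite us0 ut0 subrr.
- exact: Hd.
Qed.

(** The margin between [2 * dl] and [dl] leaves room for neighbours of a field
    that is far from the origin. *)
Lemma close_vectors (a1 a2 b1 b2 dl : R) : 0 < dl ->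
  `|a1 - b1| < dl / 2 -> `|a2 - b2| < dl / 2 -> (2 * dl) ^+ 2 <= a1 ^+ 2 + a2 ^+ 2 ->
  dl ^+ 2 <= b1 ^+ 2 + b2 ^+ 2 /\ 0 < a1 * b1 + a2 * b2.
Proof.
move=> dl0 h1 h2 ha.
have sq (z : R) : `|z| < dl / 2 -> z ^+ 2 <= dl ^+ 2 / 4.
  move=> hz; rewrite -(@ger0_norm _ (z ^+ 2)) ?sqr_ge0// normrX.
  have -> : dl ^+ 2 / 4 = (dl / 2) ^+ 2 by field.
  by rewrite ler_pXn2r ?nnegrE//; lra.
have := sq _ h1; have := sq _ h2 => k2 k1.
have d2 : 0 < dl ^+ 2 by rewrite exprn_gt0.
have := sqr_ge0 (a1 - 2 * b1); have := sqr_ge0 (a2 - 2 * b2).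
have := sqr_ge0 b1; have := sqr_ge0 b2.
by split; nra.
Qed.

(** Being at distance [2 * dl] from the origin with winding [k] propagates along
    the path: a nearby field is at distance [dl], hence has a winding, the same
    one; and if it came closer than [2 * dl] its energy would reach
    [Lambda]. *)
Lemma path_keeps_winding (L : R) (N : nat) (alpha eps Lambda dl k : R)
    (gamma : R -> R -> R * R) :
  0 < dl -> continuous_path alpha gamma ->
  gamma @` `[0, 1] `<=` sublevel L N alpha eps Lambda ->
  (forall u x0, admissible alpha u -> has_winding u k ->
    (forall x, 0 <= x -> x <= 1 -> dl ^+ 2 <= (u x).1 ^+ 2 + (u x).2 ^+ 2) ->
    0 <= x0 -> x0 <= 1 -> (u x0).1 ^+ 2 + (u x0).2 ^+ 2 < (2 * dl) ^+ 2 ->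
    (Lambda%:E <= energy L N eps u)%E) ->
  has_winding (gamma 0) k ->
  (forall x, 0 <= x -> x <= 1 -> (2 * dl) ^+ 2 <= (gamma 0 x).1 ^+ 2 + (gamma 0 x).2 ^+ 2) ->
  has_winding (gamma 1) k.
Proof.
move=> dl0 cgam sub gap W0 far0.
pose P t := has_winding (gamma t) k /\
  forall x, 0 <= x -> x <= 1 -> (2 * dl) ^+ 2 <= (gamma t x).1 ^+ 2 + (gamma t x).2 ^+ 2.
suff [] : P 1 by [].
apply: (@interval_induction _ 0 1) => // t t0 t1.
have e0 : 0 < dl / 4 by lra.
have [d d0 Hd] := path_uniformly_close cgam t0 t1 e0.
exists d => // x y x0 xt ty y1 xd yd [Wx farx].
have close z : 0 <= z -> z <= 1 ->
    `|(gamma x z).1 - (gamma y z).1| < dl / 2 /\ `|(gamma x z).2 - (gamma y z).2| < dl / 2.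
  move=> z0 z1.
  have xt_ : `|x - t| < d by rewrite ltr_norml; apply/andP; split; lra.
  have yt_ : `|y - t| < d by rewrite ltr_norml; apply/andP; split; lra.
  have [||] := Hd x _ _ xt_ z z0 z1; [lra|lra|].
  have [||] := Hd y _ _ yt_ z z0 z1; [lra|lra|].
  rewrite !ltr_norml => /andP[? ?] /andP[? ?] /andP[? ?] /andP[? ?].
  by split; apply/andP; split; lra.
have both z : 0 <= z -> z <= 1 -> _ :=
  fun z0 z1 => close_vectors dl0 (close z z0 z1).1 (close z z0 z1).2 (farx z z0 z1).
have x01 : x \in `[0, 1] by rewrite in_itv /= x0; lra.
have y01 : y \in `[0, 1] by rewrite in_itv /= y1 andbT; lra.
have [admy Ey] : sublevel L N alpha eps Lambda (gamma y) by apply: sub; exists y.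
have [admx _] : sublevel L N alpha eps Lambda (gamma x) by apply: sub; exists x.
have [k' Wy] : exists k', has_winding (gamma y) k'.
  apply: (nonvanishing_has_winding admy) => z z0 z1.
  by apply: lt_le_trans (both z z0 z1).1; rewrite exprn_gt0.
(* All fields of the path have the same value at 1. *)
have kk' : k = k'.
  apply: (winding_unique Wx Wy); last by move=> z z0 z1; exact: (both z z0 z1).2.
  by have [_ _ ->] := admx; have [_ _ ->] := admy.
rewrite -kk' in Wy; split=> // z z0 z1; rewrite leNgt; apply/negP => near0.
have := gap _ z admy Wy (fun z z0 z1 => (both z z0 z1).1) z0 z1 near0.
by rewrite leNgt Ey.
Qed.

End Path.

(** Reconciles the two ways of writing the twist energy of the first end
    point. *)
Lemma twist_constant (R : realFieldType) (p L a n m : R) : p != 0 ->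
  2 * p ^+ 2 * L * (n - m - a / (2 * p)) ^+ 2 = L / 2 * (2 * p * m + a - 2 * p * n) ^+ 2.
Proof. by move=> p0; field. Qed.

Theorem theorem4p1 (R : realType) (L : R) (N : nat) (alpha rho0 : R)
    (L_gt0 : 0 < L) (N_gt0 : (0 < N)%N)
    (alpha_ge0 : 0 <= alpha) (alpha_lt : alpha < 2 * pi)
    (rho0_gt0 : 0 < rho0) (rho0_lt1 : rho0 < 1)
    (M1 M2 : nat) (M1_gt0 : (0 < M1)%N) (M2_gt0 : (0 < M2)%N)
    (M1_neq_M2 : M1 <> M2)
    (h : R) (h_gt0 : 0 < h) :
  let Lambda_h : R :=
    2 * pi ^+ 2 * L * (N%:R - M1%:R - alpha / (2 * pi)) ^+ 2
    + 2 * Num.sqrt 2 / 3 - h in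
  exists2 eps_h : R, 0 < eps_h &
    forall eps : R, 0 < eps -> eps < eps_h ->
    forall u1 u2 : R -> R * R,
      is_u_eps_M L N alpha rho0 eps M1 u1 ->
      is_u_eps_M L N alpha rho0 eps M2 u2 ->
    forall gamma : R -> (R -> R * R),
      continuous_path alpha gamma ->
      (forall x, x \in `[0, 1] -> gamma 0 x = u1 x) ->
      (forall x, x \in `[0, 1] -> gamma 1 x = u2 x) ->
      ~ (gamma @` `[0, 1] `<=` sublevel L N alpha eps Lambda_h).
Proof.
move=> Lambda_h.
have pi0 : 0 < pi :> R by exact: pi_gt0.
(* The three losses 2 * dl, eta * 2 / 3 (each times the square root of 2,
   which is at most 3 / 2) and sg add up to less than h; the bound by
   rho0 / 2 makes the first end point start at distance 2 * dl. *)
pose dl := Num.min (h / 12) (rho0 / 2).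
pose eta := Num.min 1 (h / 3).
pose sg := h / 3.
pose k : R := 2 * pi * M1%:R + alpha - 2 * pi * N%:R.
pose Q := (k / dl ^+ 2) ^+ 2 * (L / 2 + L ^+ 2 * (k + 2 * pi * N%:R) ^+ 2 / (4 * sg)).
have dl0 : 0 < dl by rewrite lt_min; apply/andP; split; lra.
have [dlh dlr] : dl <= h / 12 /\ dl <= rho0 / 2 by rewrite !ge_min !lexx orbT.
have eta0 : 0 < eta by rewrite lt_min; apply/andP; split; lra.
have [eta1 etah] : eta <= 1 /\ eta <= h / 3 by rewrite !ge_min !lexx orbT.
have sg0 : 0 < sg by rewrite /sg; lra.
have Q0 : 0 <= Q.
  rewrite mulr_ge0 ?sqr_ge0// addr_ge0//; first lra.
  by apply: divr_ge0; [rewrite mulr_ge0 ?sqr_ge0|lra].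
have kN : k + 2 * pi * N%:R = 2 * pi * M1%:R + alpha by rewrite /k; ring.
(* Q + 1 instead of Q because Q may vanish. *)
exists (eta / (4 * (Q + 1))); first by rewrite divr_gt0//; lra.
move=> eps eps0 epslt u1 u2 Hu1 Hu2 gamma cgam gam0 gam1 sub.
have Heps : 4 * eps * Q <= eta.
  move: epslt; rewrite ltr_pdivlMr; last lra.
  by nra.
have [W0 far0] := is_u_eps_M_winding rho0_gt0 Hu1 gam0.
have [W1 far1] := is_u_eps_M_winding rho0_gt0 Hu2 gam1.
have Lambda_le : Lambda_h <= (1 - eta) * (Num.sqrt 2 * (2 / 3 - 2 * dl)) + L / 2 * k ^+ 2 - sg.
  have -> : Lambda_h = L / 2 * k ^+ 2 + 2 * Num.sqrt 2 / 3 - h.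
    by rewrite /Lambda_h twist_constant// gt_eqF.
  have s0 := sqrtr_ge0 (2 : R).
  have s2 : Num.sqrt 2 <= 3 / 2 :> R.
    have r2 : Num.sqrt 2 ^+ 2 = 2 :> R by rewrite sqr_sqrtr.
    by nra.
  have loss : 2 * dl + eta * (2 / 3 - 2 * dl) <= h * 7 / 18 by nra.
  have loss2 : Num.sqrt 2 * (2 * dl + eta * (2 / 3 - 2 * dl)) <= 2 * h / 3 by nra.
  by rewrite /sg; lra.
have W1' : has_winding (gamma 1) (2 * pi * M1%:R + alpha).
  apply: (path_keeps_winding dl0 cgam sub) => //; last first.
    move=> x x0 x1; apply: le_trans (far0 x x0 x1).
    by rewrite ler_pXn2r// ?nnegrE; lra.
  move=> u x0 admu Wu ufar x00 x01 unear.
  apply: (@le_trans _ _ ((1 - eta) * (Num.sqrt 2 * (2 / 3 - 2 * dl)) + L / 2 * k ^+ 2 - sg)%:E).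
    by rewrite lee_fin.
  by apply: (energy_gap (alpha := alpha) (x0 := x0)) => //; [exact: ltW|rewrite kN].
have pos x : 0 <= x -> x <= 1 -> 0 < (gamma 1 x).1 * (gamma 1 x).1 + (gamma 1 x).2 * (gamma 1 x).2.
  by move=> x0 x1; rewrite -!expr2; apply: lt_le_trans (far1 x x0 x1); rewrite exprn_gt0.
have /addIr/(mulfI _) E := winding_unique W1' W1 erefl pos.
apply: M1_neq_M2; apply/eqP; rewrite -(eqr_nat R); apply/eqP; apply: E.
by rewrite mulf_neq0 ?pnatr_eq0// gt_eqF.
Qed.
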